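(* Let $\mathcal T$ be the set of trimer coverings of the kagome lattice (folded trimers being identified with their vertex sets). To a covering $T\in\mathcal T$ assign an arrow pattern as follows: each outer vertex of an unfolded trimer receives an arrow pointing into the triangle which contains both that outer vertex and the inner vertex of its trimer; each inner vertex of an unfolded trimer receives the symbol $\circ$; each of the three vertices of a folded trimer receives an arrow pointing into the triangle on which the folded trimer lives. This assignment is a bijection from $\mathcal T$ onto the set of all arrow patterns satisfying, for every triangle of the kagome lattice: (i) the number of its vertices whose arrow points into the triangle minus the number of its vertices whose arrow points out of the triangle is $0 \bmod 3$; and (ii) the three vertices of the triangle do not all carry $\circ$.
   Context: The kagome lattice is the infinite planar lattice of corner-sharing triangles: each vertex belongs to exactly two triangles (one up-pointing, one down-pointing), and each edge belongs to exactly one triangle. Edges are the edges of these triangles. A trimer consists of two adjacent edges, hence covers three vertices; the vertex common to the two edges is the inner vertex and the other two are the outer vertices. A trimer is folded if its two edges lie in the same triangle (so that it covers the three vertices of that triangle), and unfolded if its two edges lie in two different triangles (which share the inner vertex). Folded trimers on the same triangle are regarded as equal, i.e. a folded trimer is just the set of three vertices of a triangle. A trimer covering is a set of trimers such that every vertex of the lattice is contained in exactly one trimer. An arrow pattern assigns to every vertex $v$ either the symbol $\circ$, or an arrow, which points into exactly one of the two triangles containing $v$ (and thus points out of the other one). *)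

(* Defs.v *)
From mathcomp Require Import all_boot all_order all_algebra.
From mathcomp Require Import boolp classical_sets functions.
Set Implicit Arguments.
Unset Strict Implicit.
Unset Printing Implicit Defensive.
Import GRing.Theory.
Local Open Scope classical_set_scope.
Local Open Scope ring_scope.

(* With a1, a2 the primitive vectors of the triangular lattice, the vertex
   (x, y, k) is the point x a1 + y a2 + d_k, where d_0 = 0, d_1 = a1 / 2 and
   d_2 = a2 / 2. *)
Definition vertex := (int * int * 'I_3)%type.

(* (x, y, true) is the up-pointing triangle with corners r, r + a1 / 2 and
   r + a2 / 2, and (x, y, false) the down-pointing triangle with corners
   r, r - a1 / 2 and r - a2 / 2, where r = x a1 + y a2. *)
Definition triangle := (int * int * bool)%type.

Definition corner (t : triangle) (k : 'I_3) : vertex :=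
  let: (x, y, up) := t in
  if up then (x, y, k) else
  match val k with
  | 0%N => (x, y, k)
  | 1%N => (x - 1, y, k)
  | _ => (x, y - 1, k)
  end.

Definition corners (t : triangle) : set vertex := range (corner t).

Definition is_edge (e : set vertex) : Prop :=
  exists t v w, [/\ corners t v, corners t w, v <> w & e = [set v; w]].

Definition adjacent (e1 e2 : set vertex) : Prop :=
  [/\ is_edge e1, is_edge e2, e1 <> e2 & e1 `&` e2 !=set0].

(* A folded trimer is recorded by its vertex set, so that the folded trimers on
   one triangle are equal; an unfolded trimer is recorded by its set of edges. *)
Inductive trimer :=
  | Folded of set vertex
  | Unfolded of set (set vertex).

Inductive is_trimer : trimer -> Prop :=
  | is_trimer_folded e1 e2 t of adjacent e1 e2 &
      e1 `<=` corners t & e2 `<=` corners t :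
      is_trimer (Folded (e1 `|` e2))
  | is_trimer_unfolded e1 e2 t1 t2 of adjacent e1 e2 &
      e1 `<=` corners t1 & e2 `<=` corners t2 & t1 <> t2 :
      is_trimer (Unfolded [set e1; e2]).

Definition covered (u : trimer) : set vertex :=
  match u with
  | Folded A => A
  | Unfolded P => \bigcup_(e in P) e
  end.

Definition inner (P : set (set vertex)) : set vertex := \bigcap_(e in P) e.

Definition outer (P : set (set vertex)) : set vertex :=
  covered (Unfolded P) `\` inner P.

Definition trimer_coverings : set (set trimer) :=
  [set T | (forall u, T u -> is_trimer u) /\
           (forall v, exists! u, T u /\ covered u v)].

(* None is the symbol "circle"; Some t is an arrow pointing into t, hence out of
   the other triangle containing the vertex. *)
Definition symbol := option triangle.

Definition is_arrow_pattern (p : vertex -> symbol) : Prop :=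
  forall v t, p v = Some t -> corners t v.

Definition points_into (t : triangle) (s : symbol) : bool := s == Some t.

(* Meaningful for the symbol of a corner of t. *)
Definition points_out (t : triangle) (s : symbol) : bool :=
  if s is Some t' then t' != t else false.

Definition num_in (p : vertex -> symbol) (t : triangle) : nat :=
  #|[pred k : 'I_3 | points_into t (p (corner t k))]|.

Definition num_out (p : vertex -> symbol) (t : triangle) : nat :=
  #|[pred k : 'I_3 | points_out t (p (corner t k))]|.

Definition admissible_patterns : set (vertex -> symbol) :=
  [set p | is_arrow_pattern p /\
     forall t : triangle,
       ((num_in p t)%:Z - (num_out p t)%:Z = 0 %[mod 3])%Z /\
       ~ (forall v, corners t v -> p v = None)].

Inductive receives (T : set trimer) (v : vertex) : symbol -> Prop :=
  | receives_outer P i t of T (Unfolded P) & inner P i & outer P v &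
      corners t v & corners t i : receives T v (Some t)
  | receives_inner P of T (Unfolded P) & inner P v : receives T v None
  | receives_folded t of T (Folded (corners t)) & corners t v :
      receives T v (Some t).

(* The default None of xget is irrelevant for coverings, where exactly one
   symbol is received at each vertex. *)
Definition arrow_pattern (T : set trimer) : vertex -> symbol :=
  fun v => xget None [set s | receives T v s].

(* Main.v *)
(** In a triangle, conditions (i) and (ii) leave only three possibilities: all
    arrows point in, all arrows point out, or there is one circle, one arrow
    pointing in and one pointing out. The pattern of a covering has this form,
    since an arrow pointing into t from an unfolded trimer comes with its inner
    vertex on t, and conversely. The inverse map sends a pattern p to the set
    of all trimers whose own marks agree with p: a vertex with an arrow into t
    is covered by the folded trimer of t, or by the unfolded trimer centred at
    the unique circle of t, whose legs are the unique arrows pointing into its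
    two triangles. *)

Require Import Defs.
From mathcomp Require Import all_boot all_order all_algebra.
From mathcomp Require Import boolp classical_sets functions.
From mathcomp Require Import zify.
Set Implicit Arguments.
Unset Strict Implicit.
Unset Printing Implicit Defensive.
Import GRing.Theory.
Local Open Scope classical_set_scope.
Local Open Scope ring_scope.

(** * Incidence of vertices and triangles in the kagome lattice *)

Lemma ord3P (i j k l : 'I_3) :
  i <> j -> i <> k -> j <> k -> [\/ l = i, l = j | l = k].
Proof.
move=> /eqP ij /eqP ik /eqP jk.
have : [|| l == i, l == j | l == k].
  move: ij ik jk (ltn_ord i) (ltn_ord j) (ltn_ord k) (ltn_ord l).
  rewrite -!val_eqE /=; lia.
by case/or3P => /eqP ->; [constructor 1 | constructor 2 | constructor 3].
Qed.

Lemma ord3_third (i j : 'I_3) : exists2 k : 'I_3, k <> i & k <> j.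
Proof.
have : [|| (0 != i :> nat) && (0 != j :> nat), (1 != i :> nat) && (1 != j :> nat)
  | (2 != i :> nat) && (2 != j :> nat)]%N by lia.
by case/or3P => /andP[/eqP ki /eqP kj];
  [exists (inord 0)|exists (inord 1)|exists (inord 2)];
  move=> /(congr1 val) /=; rewrite inordK.
Qed.

(* The triangle containing v which points up if [up], and down otherwise. *)
Definition tri (v : vertex) (up : bool) : triangle :=
  let: (x, y, k) := v in
  if up then (x, y, true) else
  match val k with
  | 0%N => (x, y, false)
  | 1%N => (x + 1, y, false)
  | _ => (x, y + 1, false)
  end.

Lemma tri_orientation v b : (tri v b).2 = b.
Proof. by case: v => [[x y] [[|[|k]] //= _]]; case: b. Qed.

Lemma corner_index t k : (corner t k).2 = k.
Proof. by case: t => [[x y] []] //=; case: k => [[|[|k]] Hk]. Qed.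

Lemma corner_inj t : injective (corner t).
Proof. by move=> i j eq_ij; rewrite -(corner_index t i) eq_ij corner_index. Qed.

Lemma tri_corner t k : tri (corner t k) t.2 = t.
Proof.
case: t => [[x y] []] //=; case: k => [[|[|k]] Hk] //=; by rewrite subrK.
Qed.

Lemma corner_tri v b : corner (tri v b) v.2 = v.
Proof.
case: v => [[x y] [[|[|k]] Hk]]; case: b => //=; by rewrite addrK.
Qed.

Lemma corners_corner t k : corners t (corner t k).
Proof. by exists k. Qed.

Lemma cornersP t v : corners t v <-> tri v t.2 = t.
Proof.
split=> [[k _ <-] | <-]; first exact: tri_corner.
by exists v.2; rewrite // corner_tri.
Qed.

Lemma corners_tri v b : corners (tri v b) v.
Proof. by apply/cornersP; rewrite tri_orientation. Qed.

Lemma corners_tri_eq t v : corners t v -> t = tri v t.2.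
Proof. by move/cornersP. Qed.

(** An up-pointing and a down-pointing triangle share at most one vertex, and among triangles of one
    orientation a single vertex already determines the triangle. *)
Lemma two_corners t t' v w : v <> w ->
  corners t v -> corners t w -> corners t' v -> corners t' w -> t = t'.
Proof.
have up_down u d : u.2 = true -> d.2 = false -> v <> w ->
    corners u v -> corners u w -> corners d v -> corners d w -> False.
  case: u d => [[x y] []] // [[x' y'] []] // _ _ vw.
  move=> [i _ iv] [j _ jw] [k _ kv] [l _ lw].
  (* The last coordinate of a vertex is its corner index in both of its triangles. With equal
     indices, two distinct shared corners would impose contradictory offsets between [(x, y)] and
     [(x', y')]. *)
  have ki : k = i by rewrite -(corner_index (x', y', false) k) kv -iv corner_index.
  have lj : l = j by rewrite -(corner_index (x', y', false) l) lw -jw corner_index.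
  subst v w k l; apply: vw; move: kv lw => /=.
  by case: i j => [[|[|[|i]]] Hi] // [[|[|[|j]]] Hj] //= [] ? ? [] ? ?;
     first [lia | congr (_, _, _); apply: val_inj].
move=> vw tv tw t'v t'w.
case eb: t.2; case eb': t'.2.
- by rewrite (corners_tri_eq tv) (corners_tri_eq t'v) eb eb'.
- by case: (up_down t t').
- by case: (up_down t' t).
- by rewrite (corners_tri_eq tv) (corners_tri_eq t'v) eb eb'.
Qed.

Lemma corners_distinct t i j k v : i <> j -> i <> k -> j <> k ->
  corners t v -> [\/ v = corner t i, v = corner t j | v = corner t k].
Proof.
move=> ij ik jk [l _ <-].
by case: (ord3P l ij ik jk) => ->; [constructor 1|constructor 2|constructor 3].
Qed.

(** * Local analysis of conditions (i) and (ii) on one triangle *)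

Lemma card_ord3 (P : pred 'I_3) (i j k : 'I_3) : i <> j -> i <> k -> j <> k ->
  #|P| = (P i + P j + P k)%N.
Proof.
move=> ij ik jk; rewrite -sum1_card big_mkcond /=.
rewrite (bigD1 i) // (bigD1 j) /=; last by apply/eqP => /esym.
rewrite (bigD1 k) /=; last by apply/andP; split; apply/eqP => /esym.
rewrite big1 ?addn0 ?addnA; first by rewrite !unfold_in; do 3 case: (P _).
move=> l /andP[/andP[/eqP li /eqP lj] /eqP lk].
by case: (ord3P l ij ik jk).
Qed.

Definition locally_admissible (p : vertex -> symbol) (t : triangle) : Prop :=
  ((num_in p t)%:Z - (num_out p t)%:Z = 0 %[mod 3])%Z /\
  ~ (forall v, corners t v -> p v = None).

(** In the third case [c] and [w] differ because their symbols do, so the last clause concerns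
    exactly one corner. *)
Definition in_out_profile (p : vertex -> symbol) (t : triangle) : Prop :=
  [\/ forall v, corners t v -> p v = Some t,
      forall v, corners t v -> points_out t (p v)
    | exists c w, [/\ corners t c, corners t w, p c = None, p w = Some t &
        forall v, corners t v -> v <> c -> v <> w -> points_out t (p v)]].

(** A case view: splitting on a symbol evaluates both of its direction tests at once, which turns
    the counts into numerals. *)
Variant symbol_spec (t : triangle) : symbol -> bool -> bool -> Prop :=
  | SymbolNone : symbol_spec t None false false
  | SymbolIn : symbol_spec t (Some t) true false
  | SymbolOut t' of t' != t : symbol_spec t (Some t') false true.

Lemma symbolP t s : symbol_spec t s (points_into t s) (points_out t s).
Proof.
case: s => [t'|]; last exact: SymbolNone.
rewrite /points_into /points_out -[Some t' == _]/(t' == t).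
by case: eqVneq => [->|ne]; [exact: SymbolIn | exact: SymbolOut].
Qed.

Lemma points_into_arrow t : points_into t (Some t).
Proof. exact: eqxx. Qed.

Lemma locally_admissibleP p t : locally_admissible p t <-> in_out_profile p t.
Proof.
have counts (i j k : 'I_3) : i <> j -> i <> k -> j <> k ->
    (num_in p t = points_into t (p (corner t i)) + points_into t (p (corner t j))
       + points_into t (p (corner t k)))%N /\
    (num_out p t = points_out t (p (corner t i)) + points_out t (p (corner t j))
       + points_out t (p (corner t k)))%N.
  by move=> ij ik jk; split; exact: card_ord3.
split=> [[mod3 notall]|].
  (* With a circle at [i], the other two symbols contribute between -2 and 2, so they cancel: two
     more circles, excluded by (ii), or one arrow in and one out. *)
  have [[i pi]|noNone] := pselect (exists i, p (corner t i) = None).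
    have [j ji _] := ord3_third i i.
    have [k ki kj] := ord3_third i j.
    have [ij ik jk] : [/\ i <> j, i <> k & j <> k] by split; apply: nesym.
    have [Ein Eout] := counts i j k ij ik jk.
    have some_arrow : ~ (p (corner t j) = None /\ p (corner t k) = None).
      case=> pj pk; apply: notall => v tv.
      by case: (corners_distinct ij ik jk tv) => ->.
    move: mod3 some_arrow; rewrite {}Ein {}Eout pi /=.
    move Ej: (p (corner t j)) => sj; move Ek: (p (corner t k)) => sk.
    case: (symbolP t sj) Ej => [|| t' t't] Ej;
      case: (symbolP t sk) Ek => [|| t'' t''t] Ek //= _ some_arrow.
    - by case: some_arrow.
    - constructor 3; exists (corner t i), (corner t j).
      split=> //; try exact: corners_corner.
      by move=> v tv; case: (corners_distinct ij ik jk tv) => -> //; rewrite Ek.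
    - constructor 3; exists (corner t i), (corner t k).
      split=> //; try exact: corners_corner.
      by move=> v tv; case: (corners_distinct ij ik jk tv) => -> //; rewrite Ej.
  (* Without circles the difference is 3, 1, -1 or -3, and divisibility by 3 forces all arrows to
     agree. *)
  have [j ji _] := ord3_third ord0 ord0.
  have [k ki kj] := ord3_third ord0 j.
  have [ij ik jk] : [/\ ord0 <> j, ord0 <> k & j <> k] by split; apply: nesym.
  have [Ein Eout] := counts _ j k ij ik jk.
  move: mod3; rewrite {}Ein {}Eout.
  move Ei: (p (corner t ord0)) => si.
  move Ej: (p (corner t j)) => sj; move Ek: (p (corner t k)) => sk.
  case: (symbolP t si) Ei => [|| ti tit] Ei; first by case: noNone; exists ord0.
    case: (symbolP t sj) Ej => [|| tj tjt] Ej; first by case: noNone; exists j.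
      case: (symbolP t sk) Ek => [|| tk tkt] Ek //.
      by constructor 1 => v tv; case: (corners_distinct ij ik jk tv) => ->.
    by case: (symbolP t sk) Ek => [|| ? ?] Ek //; case: noNone; exists k.
  case: (symbolP t sj) Ej => [|| tj tjt] Ej; first by case: noNone; exists j.
    by case: (symbolP t sk) Ek => [|| ? ?] Ek //; case: noNone; exists k.
  case: (symbolP t sk) Ek => [|| tk tkt] Ek //.
  constructor 2 => v tv.
  by case: (corners_distinct ij ik jk tv) => ->; rewrite ?Ei ?Ej ?Ek.
have [j ji _] := ord3_third ord0 ord0.
have [k ki kj] := ord3_third ord0 j.
have [ij ik jk] : [/\ ord0 <> j, ord0 <> k & j <> k] by split; apply: nesym.
have in_not_out s : points_out t s -> points_into t s = false.
  by case: (symbolP t s).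
case=> [all_in|all_out|[_ [_ [[i _ <-] [l _ <-] pi pl out]]]].
- have [Ein Eout] := counts _ j k ij ik jk; split.
    by rewrite Ein Eout !(all_in _ (corners_corner t _)) points_into_arrow
      /points_out eqxx.
  move=> all_none; have := all_none _ (corners_corner t ord0).
  by rewrite all_in //; exact: corners_corner.
- have [Ein Eout] := counts _ j k ij ik jk; split.
    rewrite Ein Eout !(in_not_out _ (all_out _ (corners_corner t _))).
    by rewrite !(all_out _ (corners_corner t _)).
  move=> all_none; have := all_out _ (corners_corner t ord0).
  by rewrite all_none //; exact: corners_corner.
have il : i <> l by move=> eq_il; rewrite eq_il pl in pi.
have [m mi ml] := ord3_third i l.
have [im lm] : i <> m /\ l <> m by split; apply: nesym.
have pm : points_out t (p (corner t m)).
  by apply: out; [exact: corners_corner | move/corner_inj | move/corner_inj].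
have [Ein Eout] := counts _ _ _ il im lm; split.
  by rewrite Ein Eout pi pl pm (in_not_out _ pm) points_into_arrow
    /points_out eqxx.
by move=> all_none; rewrite all_none in pl; last exact: corners_corner.
Qed.

(** * Unfolded trimers described by their inner vertex and two legs *)

(* The unfolded trimer with inner vertex c and outer vertices w true, w false,
   where w b lies in the triangle at c of orientation b. *)
Definition spans (c : vertex) (w : bool -> vertex) : Prop :=
  forall b, corners (tri c b) (w b) /\ w b <> c.

Definition legs (c : vertex) (w : bool -> vertex) : set (set vertex) :=
  [set [set c; w true]; [set c; w false]].

Section Legs.
Variables (c : vertex) (w : bool -> vertex).
Hypothesis cw : spans c w.

(** By [two_corners], the distinct vertices [c] and [w b] lie together in only one triangle, so
    [w b] recovers the orientation [b]. *)
Lemma spans_triangle b b' : corners (tri c b') (w b) -> b' = b.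
Proof.
move=> wb'; have [wb wc] := cw b.
rewrite -(tri_orientation c b') -(tri_orientation c b); congr (_.2).
exact: (two_corners wc wb' (corners_tri _ _) wb (corners_tri _ _)).
Qed.

Lemma spans_inj b b' : w b = w b' -> b = b'.
Proof. by move=> eqw; apply: spans_triangle; rewrite -eqw; case: (cw b). Qed.

Lemma inner_legs : inner (legs c w) = [set c].
Proof.
apply/seteqP; split=> v /=; last by move=> -> _ [] ->; left.
move=> cap; have [//|vt] := cap _ (or_introl erefl).
by have [//|vf] := cap _ (or_intror erefl); move: (vt); rewrite vf => /spans_inj.
Qed.

Lemma covered_legs v :
  covered (Unfolded (legs c w)) v <-> v = c \/ exists b, v = w b.
Proof.
split=> [[_ [] -> [] ->]|]; try by left.
- by right; exists true.
- by right; exists false.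
case=> [->|[[] ->]].
- by exists [set c; w true]; [left|left].
- by exists [set c; w true]; [left|right].
- by exists [set c; w false]; [right|right].
Qed.

Lemma outer_legs v : outer (legs c w) v <-> exists b, v = w b.
Proof.
rewrite /outer inner_legs; split=> [[/covered_legs[->|//] []]//|[b vb]].
split; first by apply/covered_legs; right; exists b.
by move=> /= vc; case: (cw b) => _ []; rewrite -vb.
Qed.

Lemma spans_edge b : is_edge [set c; w b].
Proof.
have [wb wc] := cw b.
by exists (tri c b), c, (w b); split=> //; [exact: corners_tri | exact: nesym].
Qed.

Lemma is_trimer_legs : is_trimer (Unfolded (legs c w)).
Proof.
have sub b : [set c; w b] `<=` corners (tri c b).
  by move=> v [] ->; [exact: corners_tri | case: (cw b)].
apply: (@is_trimer_unfolded _ _ (tri c true) (tri c false)) => //.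
  split; try exact: spans_edge; last by exists c; split; left.
  move=> eq_edges; have : [set c; w true] (w true) by right.
  rewrite eq_edges => -[]; first by case: (cw true).
  by move/spans_inj.
by move/(congr1 snd); rewrite !tri_orientation.
Qed.

End Legs.

(** The inner vertex is the intersection of the two edges, and [w b] is the only outer vertex in the
    triangle of orientation [b] at it. *)
Lemma legs_inj c c' w w' : spans c w -> spans c' w' ->
  legs c w = legs c' w' -> c = c' /\ w = w'.
Proof.
move=> cw cw' eq_legs.
have cc' : c = c'.
  have : inner (legs c w) c by rewrite inner_legs.
  by rewrite eq_legs inner_legs.
subst c'; split=> //; apply: funext => b.
have : outer (legs c w) (w b) by apply/outer_legs => //; exists b.
rewrite eq_legs => /(outer_legs cw')[b' wb].
have [wbt _] := cw b; rewrite wb in wbt.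
by rewrite wb (spans_triangle cw' wbt).
Qed.

(** * Classification of folded and unfolded trimers *)

Lemma edge_other e v : is_edge e -> e v -> exists2 w, w <> v & e = [set v; w].
Proof.
move=> [t [x [y [_ _ xy ->]]]] [->|->]; first by exists y => //; exact: nesym.
by exists x => //; rewrite setUC.
Qed.

Lemma adjacent_common e1 e2 : adjacent e1 e2 -> exists v w1 w2,
  [/\ w1 <> v, w2 <> v, w1 <> w2, e1 = [set v; w1] & e2 = [set v; w2]].
Proof.
move=> [edge1 edge2 ne [v [e1v e2v]]].
have [w1 w1v def1] := edge_other edge1 e1v.
have [w2 w2v def2] := edge_other edge2 e2v.
by exists v, w1, w2; split=> // eqw; apply: ne; rewrite def1 def2 eqw.
Qed.

Lemma corner_edge t i j : i <> j -> is_edge [set corner t i; corner t j].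
Proof.
move=> ij; exists t, (corner t i), (corner t j).
by split=> //; try exact: corners_corner; move/corner_inj.
Qed.

(** Two distinct edges with a common vertex cover three distinct vertices, hence all corners of a
    triangle that contains both edges. *)
Lemma is_trimer_foldedP A : is_trimer (Folded A) <-> exists t, A = corners t.
Proof.
split=> [tri_u|[t ->]].
  inversion tri_u as [e1 e2 t adj sub1 sub2 defA|]; exists t; subst A.
  have [v [w1 [w2 [w1v w2v w12 def1 def2]]]] := adjacent_common adj.
  apply/seteqP; split=> [x [/sub1|/sub2]//|x].
  have [i _ iv] : corners t v by apply: sub1; rewrite def1; left.
  have [j _ jw] : corners t w1 by apply: sub1; rewrite def1; right.
  have [k _ kw] : corners t w2 by apply: sub2; rewrite def2; right.
  rewrite def1 def2; subst v w1 w2.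
  case/(@corners_distinct t i j k); first by move=> eqi; apply: w1v; rewrite eqi.
  - by move=> eqi; apply: w2v; rewrite eqi.
  - by move=> eqi; apply: w12; rewrite eqi.
  - by left; left.
  - by left; right.
  - by right; right.
have [j ji _] := ord3_third ord0 ord0.
have [k ki kj] := ord3_third ord0 j.
have [ij ik jk] : [/\ ord0 <> j, ord0 <> k & j <> k] by split; apply: nesym.
set e1 := [set corner t ord0; corner t j].
set e2 := [set corner t ord0; corner t k].
have -> : corners t = e1 `|` e2.
  apply/seteqP; split=> v.
    by case/(corners_distinct ij ik jk) => ->; [left; left|left; right|right; right].
  by case=> -[] ->; exact: corners_corner.
apply: (@is_trimer_folded _ _ t).
- split; try exact: corner_edge; last by exists (corner t ord0); split; left.
  move=> eq12; have : e1 (corner t j) by right.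
  by rewrite eq12 => -[] /corner_inj.
- by move=> v [] ->; exact: corners_corner.
- by move=> v [] ->; exact: corners_corner.
Qed.

(** Distinct triangles through the common vertex have opposite orientations, so the two edges can be
    indexed by orientation. *)
Lemma is_trimer_unfoldedP P :
  is_trimer (Unfolded P) <-> exists c w, spans c w /\ P = legs c w.
Proof.
split=> [tri_u|[c [w [cw ->]]]]; last exact: is_trimer_legs.
inversion tri_u as [|e1 e2 t1 t2 adj sub1 sub2 ne defP]; subst P.
have [v [w1 [w2 [w1v w2v w12 def1 def2]]]] := adjacent_common adj.
have t1v : corners t1 v by apply: sub1; rewrite def1; left.
have t1w : corners t1 w1 by apply: sub1; rewrite def1; right.
have t2v : corners t2 v by apply: sub2; rewrite def2; left.
have t2w : corners t2 w2 by apply: sub2; rewrite def2; right.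
have def_t1 := corners_tri_eq t1v; have def_t2 := corners_tri_eq t2v.
have opp : t2.2 = ~~ t1.2.
  by case: (boolP t2.2) (boolP t1.2) => b2 [] b1 //; case: ne;
    rewrite def_t1 def_t2 ?(negPf b1) ?(negPf b2) ?b1 ?b2.
rewrite opp in def_t2.
(* The edge in [t1] becomes the leg of orientation [t1.2]. The possible swap is harmless, as the
   pair of edges is unordered. *)
exists v, (fun b => if b == t1.2 then w1 else w2); split.
  move=> b; case: eqVneq => [->|]; first by rewrite -def_t1.
  have neg_b : b != t1.2 -> b = ~~ t1.2 by case: b t1.2 => [] [].
  by move/neg_b => ->; rewrite -def_t2.
rewrite /legs def1 def2; case: t1.2 => //=; exact: setUC.
Qed.

Lemma corners_injective : injective corners.
Proof.
move=> t t' eqt; have [j j0 _] := ord3_third ord0 ord0.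
apply: (@two_corners t t' (corner t j) (corner t ord0)); rewrite -?eqt;
  try exact: corners_corner.
by move/corner_inj.
Qed.

(** * Symbols prescribed by a single trimer *)

(** The assignment rule read off one trimer, without reference to a covering, so that the same
    relation serves both for coverings and for testing a trimer against a given pattern. *)
Definition marks (u : trimer) (v : vertex) (s : symbol) : Prop :=
  match u with
  | Folded A => exists t, [/\ A = corners t, corners t v & s = Some t]
  | Unfolded P => exists c w, [/\ spans c w, P = legs c w &
      (v = c /\ s = None) \/ exists b, v = w b /\ s = Some (tri c b)]
  end.

Lemma marks_inner c w : spans c w -> marks (Unfolded (legs c w)) c None.
Proof. by move=> cw; exists c, w; split=> //; left. Qed.

Lemma marks_outer c w b :
  spans c w -> marks (Unfolded (legs c w)) (w b) (Some (tri c b)).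
Proof. by move=> cw; exists c, w; split=> //; right; exists b. Qed.

Lemma marks_folded t v : corners t v -> marks (Folded (corners t)) v (Some t).
Proof. by exists t. Qed.

Lemma marks_functional u v s s' : marks u v s -> marks u v s' -> s = s'.
Proof.
case: u => [A|P] /=.
  by move=> [t [-> _ ->]] [t' [/corners_injective -> _ ->]].
move=> [c [w [cw -> mark]]] [c' [w' [cw' eq_legs mark']]].
have [? ?] := legs_inj cw cw' eq_legs; subst c' w'.
case: mark mark' => [[-> ->]|[b [-> ->]]] [[vc ->]|[b' [vb ->]]] //.
- by case: (cw b') => _ [].
- by case: (cw b) => _ [].
- by rewrite (spans_inj cw vb).
Qed.

Lemma marks_covered u v s : marks u v s -> covered u v.
Proof.
case: u => [A [t [-> tv _]] //|P [c [w [cw -> mark]]]].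
apply/covered_legs; case: mark => [[-> _]|[b [-> _]]]; first by left.
by right; exists b.
Qed.

Lemma covered_marks u v : is_trimer u -> covered u v -> exists s, marks u v s.
Proof.
case: u => [A /is_trimer_foldedP[t ->] /= tv|P].
  by exists (Some t); exact: marks_folded.
move=> /is_trimer_unfoldedP[c [w [cw ->]]] /covered_legs[->|[b ->]].
  by exists None; exact: marks_inner.
by exists (Some (tri c b)); exact: marks_outer.
Qed.

Lemma covered_nonempty u : is_trimer u -> exists v, covered u v.
Proof.
case: u => [A /is_trimer_foldedP[t ->]|P /is_trimer_unfoldedP[c [w [cw ->]]]].
  by exists (corner t ord0); exact: corners_corner.
by exists c; apply: marks_covered; exact: marks_inner.
Qed.

Lemma receivesP T v s : (forall u, T u -> is_trimer u) ->
  receives T v s <-> exists2 u, T u & marks u v s.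
Proof.
move=> trimT; split.
  case=> [P i t TP|P TP|t TA tv]; last by exists (Folded (corners t)); last exists t.
    have /is_trimer_unfoldedP[c [w [cw defP]]] := trimT _ TP; subst P.
    rewrite (inner_legs cw) => -> /(outer_legs cw)[b ->] twb tc.
    exists (Unfolded (legs c w)) => //.
    have [cwb wbc] := cw b.
    (* The triangle [t] contains both the outer and the inner vertex, which makes it the triangle of
       that leg. *)
    rewrite (two_corners wbc twb tc cwb (corners_tri _ _)).
    exact: marks_outer.
  have /is_trimer_unfoldedP[c [w [cw defP]]] := trimT _ TP; subst P.
  rewrite (inner_legs cw) => ->; exists (Unfolded (legs c w)) => //.
  exact: marks_inner.
case=> -[A|P] Tu /=; first by case=> t [? tv ->]; subst A; exact: receives_folded.
case=> c [w [cw defP [[-> ->]|[b [-> ->]]]]].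
  by apply: (receives_inner Tu); rewrite defP inner_legs.
have [cwb wbc] := cw b.
apply: (receives_outer Tu (i := c)) => //; last exact: corners_tri.
  by rewrite defP inner_legs.
by rewrite defP; apply/outer_legs => //; exists b.
Qed.

(** * From a covering to an admissible pattern *)

Section Covering.
Variable T : set trimer.
Hypothesis covT : trimer_coverings T.

Let trimT u : T u -> is_trimer u. Proof. by case: covT => + _; apply. Qed.

Lemma covering_unique u u' v s s' :
  T u -> T u' -> marks u v s -> marks u' v s' -> u = u'.
Proof.
move=> Tu Tu' mu mu'; case: covT => _ /(_ v)[u0 [_ uniq_u0]].
rewrite -(uniq_u0 u); last by split; last exact: marks_covered mu.
by apply: uniq_u0; split; last exact: marks_covered mu'.
Qed.

Lemma receives_exists_unique v : exists! s, receives T v s.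
Proof.
case: covT => _ /(_ v)[u [[Tu uv] _]].
have [s mark] := covered_marks (trimT Tu) uv.
exists s; split; first by apply/receivesP => //; exists u.
move=> s' /(receivesP _ _ trimT)[u' Tu' mark'].
have eqU := covering_unique Tu Tu' mark mark'; subst u'.
exact: marks_functional mark mark'.
Qed.

(** Existence and uniqueness of the received symbol turn the value chosen by [xget] into a relation
    that later proofs can destruct. *)
Lemma arrow_pattern_marks v s :
  arrow_pattern T v = s <-> exists2 u, T u & marks u v s.
Proof.
have [s0 [recv uniq_s0]] := receives_exists_unique v.
have -> : arrow_pattern T v = s0.
  by apply: xget_unique => //= s' /uniq_s0.
split=> [<-|]; first exact/receivesP.
by move=> ?; apply: uniq_s0; apply/receivesP.
Qed.

Lemma arrow_pattern_arrow : is_arrow_pattern (arrow_pattern T).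
Proof.
move=> v t /arrow_pattern_marks[[A|P] _ /=]; first by case=> t' [_ tv [->]].
case=> c [w [cw _ [[]//|[b [-> [->]]]]]].
by case: (cw b).
Qed.

(** A folded trimer on [t] makes all arrows point in. Otherwise each arrow into [t] brings a circle
    on [t], and each circle brings an arrow into [t]: no circle means all arrows out, and a circle
    with its leg leaves a third corner that must point out. *)
Lemma arrow_pattern_profile t : in_out_profile (arrow_pattern T) t.
Proof.
set p := arrow_pattern T.
have pM u v s : T u -> marks u v s -> p v = s.
  by move=> Tu mark; apply/arrow_pattern_marks; exists u.
have [Tt|notTt] := pselect (T (Folded (corners t))).
  by constructor 1 => v tv; apply: (pM _ _ _ Tt); exact: marks_folded.
(* An arrow into t not coming from a folded trimer points towards an inner
   vertex on t. *)
have arrow_in v : p v = Some t -> exists c w b,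
    [/\ spans c w, T (Unfolded (legs c w)), t = tri c b & v = w b].
  move=> /arrow_pattern_marks[[A|P] Tu /=].
    by case=> t' [defA _ [eqt]]; case: notTt; rewrite eqt -defA.
  case=> c [w [cw defP [[]//|[b [-> [->]]]]]].
  by exists c, w, b; split=> //; rewrite -defP.
have pNone c w : spans c w -> T (Unfolded (legs c w)) -> p c = None.
  by move=> cw Tu; apply: (pM _ _ _ Tu); exact: marks_inner.
have [[c tc pc]|noNone] := pselect (exists2 c, corners t c & p c = None); last first.
  constructor 2 => v tv; move pv: (p v) => s; case: (symbolP t s) pv => // [pv|].
    by case: noNone; exists v.
  move=> /arrow_in[c [w [b [cw Tu tcb _]]]]; case: noNone; exists c.
    by rewrite tcb; exact: corners_tri.
  exact: pNone cw Tu.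
have inner_at v : p v = None -> exists2 w, spans v w & T (Unfolded (legs v w)).
  move=> /arrow_pattern_marks[[A|P] Tu /=]; first by case=> ? [].
  case=> c' [w [cw defP [[-> _]|[b []//]]]].
  by exists w => //; rewrite -defP.
have [w cw Tu] := inner_at _ pc.
have def_t := corners_tri_eq tc; set b := t.2 in def_t.
have [twb wbc] := cw b; rewrite -def_t in twb.
have pwb : p (w b) = Some t.
  by rewrite def_t; apply: (pM _ _ _ Tu); exact: marks_outer.
constructor 3; exists c, (w b); split=> // v tv vc vwb.
have third x : corners t x -> [\/ x = c, x = w b | x = v].
  case: tc twb tv (wbc) vc vwb => [i _ <-] [j _ <-] [k _ <-] ji ki kj.
  by apply: corners_distinct => eqi; [apply: ji|apply: ki|apply: kj]; rewrite eqi.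
move pv: (p v) => s; case: (symbolP t s) pv => // pv.
  (* If [v] were a circle, its leg in [t] could end only at [w b], which the trimer centred at [c]
     already covers. *)
  have [w' vw' Tu'] := inner_at _ pv.
  have def_t' := corners_tri_eq tv; rewrite -/b in def_t'.
  have [twb' wbv'] := vw' b; rewrite -def_t' in twb'.
  have pwb' : p (w' b) = Some t.
    by rewrite def_t'; apply: (pM _ _ _ Tu'); exact: marks_outer.
  case: (third _ twb') => // eqw; first by rewrite eqw pc in pwb'.
  have m1 := marks_outer b cw; have m2 := marks_outer b vw'; rewrite eqw in m2.
  have [eq_legs] := covering_unique Tu Tu' m1 m2.
  by have [eqc _] := legs_inj cw vw' eq_legs; case: vc.
(* If [v] pointed in, its inner vertex would be the only circle [c], whose leg in [t] ends at [w b]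
   and not at [v]. *)
have [c' [w' [b' [cw' Tu' def_t' vw']]]] := arrow_in v pv.
have tc' : corners t c' by rewrite def_t'; exact: corners_tri.
have pc' := pNone _ _ cw' Tu'.
have eqb : b' = b by rewrite /b def_t' tri_orientation.
subst b'; case: (third _ tc') => eqc'.
- subst c'.
  have [eq_legs] := covering_unique Tu Tu' (marks_inner cw) (marks_inner cw').
  by have [_ eqw] := legs_inj cw cw' eq_legs; case: vwb; rewrite eqw.
- by rewrite eqc' pwb in pc'.
- by rewrite eqc' pv in pc'.
Qed.

End Covering.

(** * From an admissible pattern to a covering *)

Definition compatible (p : vertex -> symbol) : set trimer :=
  [set u | is_trimer u /\ forall v s, marks u v s -> p v = s].

Lemma compatible_folded p t : (forall v, corners t v -> p v = Some t) ->
  compatible p (Folded (corners t)).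
Proof.
move=> pt; split; first by apply/is_trimer_foldedP; exists t.
by move=> v s [t' [/corners_injective <- tv ->]]; exact: pt.
Qed.

Lemma compatible_legs p c w : spans c w -> p c = None ->
  (forall b, p (w b) = Some (tri c b)) -> compatible p (Unfolded (legs c w)).
Proof.
move=> cw pc pw; split; first exact: is_trimer_legs.
move=> v s [c' [w' [cw' eq_legs mark]]].
have [? ?] := legs_inj cw cw' eq_legs; subst c' w'.
by case: mark => [[-> ->]|[b [-> ->]]].
Qed.

Section Admissible.
Variable p : vertex -> symbol.
Hypothesis arrow_p : is_arrow_pattern p.
Hypothesis profile_p : forall t, in_out_profile p t.

(** A circle rules out the two uniform profiles, and the mixed one has a single arrow pointing in.
    This determines the leg in [t] of a trimer centred at [c]. *)
Lemma arrow_at_circle t c : corners t c -> p c = None ->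
  exists w, [/\ corners t w, p w = Some t &
    forall v, corners t v -> p v = Some t -> v = w].
Proof.
move=> tc pc; case: (profile_p t) => [/(_ c tc)|/(_ c tc)|]; rewrite ?pc //.
move=> [c' [w [tc' tw pc' pw out]]]; exists w; split=> // v tv pv.
have [//|vw] := pselect (v = w); have vc' : v <> c' by move=> eqv; rewrite eqv pc' in pv.
by have := out v tv vc' vw; rewrite pv /points_out eqxx.
Qed.

(** The dual statement: an arrow into [t] comes from a folded trimer or determines the inner vertex
    of its unfolded one. *)
Lemma circle_at_arrow t v : p v = Some t ->
  (forall w, corners t w -> p w = Some t) \/
  exists c, [/\ corners t c, p c = None &
    forall c', corners t c' -> p c' = None -> c' = c].
Proof.
move=> pv; have tv := arrow_p pv.
case: (profile_p t) => [?|/(_ v tv)|]; [by left|by rewrite pv /points_out eqxx|].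
move=> [c [w [tc tw pc pw out]]]; right; exists c; split=> // c' tc' pc'.
have [//|ne] := pselect (c' = c); have c'w : c' <> w by move=> eqc; rewrite eqc pw in pc'.
by have := out c' tc' ne c'w; rewrite pc'.
Qed.

Lemma circle_trimer c : p c = None ->
  exists2 w, spans c w & compatible p (Unfolded (legs c w)).
Proof.
move=> pc.
(* One leg is selected in each of the two triangles at [c]. *)
have /choice[w ww] : forall b, exists w, corners (tri c b) w /\ p w = Some (tri c b).
  by move=> b; have [w [? ? _]] := arrow_at_circle (corners_tri c b) pc; exists w.
have cw : spans c w.
  by move=> b; have [tw pw] := ww b; split=> // eqw; rewrite eqw pc in pw.
by exists w => //; apply: compatible_legs => // b; have [] := ww b.
Qed.

Lemma compatible_legs_unique c w w' : spans c w -> spans c w' ->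
  compatible p (Unfolded (legs c w)) -> compatible p (Unfolded (legs c w')) ->
  w = w'.
Proof.
move=> cw cw' [_ compw] [_ compw']; apply: funext => b.
have pc := compw _ _ (marks_inner cw).
have [w0 [_ _ uniq_w]] := arrow_at_circle (corners_tri c b) pc.
have [tw _] := cw b; have [tw' _] := cw' b.
rewrite (uniq_w _ tw (compw _ _ (marks_outer b cw))).
by rewrite (uniq_w _ tw' (compw' _ _ (marks_outer b cw'))).
Qed.

Lemma compatible_marks_exists v : exists2 u, compatible p u & marks u v (p v).
Proof.
case pv: (p v) => [t|]; last first.
  have [w vw comp] := circle_trimer pv.
  by exists (Unfolded (legs v w)) => //; exact: marks_inner.
have tv := arrow_p pv.
have [all_in|[c [tc pc _]]] := circle_at_arrow pv.
  by exists (Folded (corners t)); [exact: compatible_folded | exact: marks_folded].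
have [w cw comp] := circle_trimer pc; exists (Unfolded (legs c w)) => //.
have [w0 [_ _ uniq_w]] := arrow_at_circle tc pc.
have def_t := corners_tri_eq tc.
have mark := marks_outer t.2 cw; rewrite -def_t in mark.
(* Both [v] and the leg [w t.2] carry an arrow into [t], so each equals the unique such vertex
   [w0]. *)
rewrite (uniq_w v tv pv) -(uniq_w (w t.2)) //; last by case: comp => _; exact.
by have [+ _] := cw t.2; rewrite -def_t.
Qed.

(** A folded and an unfolded trimer cannot mark [v] with the same arrow into [t]: the first fills
    [t] with arrows, the second puts a circle there. Two unfolded ones share their inner vertex, and
    hence their legs. *)
Lemma compatible_marks_unique u u' v s : compatible p u -> compatible p u' ->
  marks u v s -> marks u' v s -> u = u'.
Proof.
have folded_legs A P t : compatible p (Folded A) -> compatible p (Unfolded P) ->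
    marks (Folded A) v (Some t) -> marks (Unfolded P) v (Some t) -> False.
  move=> [_ compA] [_ compP] [t' [defA _ [eqt]]].
  move=> [c [w [cw defP [[]//|[b [_ [def_t]]]]]]]; subst A t' P.
  have pc := compP _ _ (marks_inner cw).
  have tc : corners t c by rewrite def_t; exact: corners_tri.
  by rewrite (compA _ _ (marks_folded tc)) in pc.
case: u u' => [A|P] [A'|P'] comp comp' mark mark'.
all: have pv : p v = s by case: comp => _; exact.
- by case: mark mark' => [t [-> _ ->]] [t' [-> _ [->]]].
- by case: (mark) => t [_ _ eqs]; rewrite eqs in mark mark'; case: (folded_legs A P' t).
- by case: (mark') => t [_ _ eqs]; rewrite eqs in mark mark'; case: (folded_legs A' P t).
case: (mark) => c [w [cw defP mk]]; case: (mark') => c' [w' [cw' defP' mk']].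
subst P P'; suff eqc : c = c'.
  by subst c'; rewrite (compatible_legs_unique cw cw' comp comp').
have pc : p c = None by case: comp => _; apply; exact: marks_inner.
have pc' : p c' = None by case: comp' => _; apply; exact: marks_inner.
(* If [v] is a circle, it is itself both inner vertices. If it has an arrow, both inner vertices are
   circles on the triangle it points into, which has only one. *)
case: mk mk' pv => [[-> ->]|[b [_ ->]]] [[<- //]|[b' [_ [def_t]]]] // pv.
have tc := corners_tri c b; have tc' := corners_tri c' b'; rewrite -def_t in tc'.
have [all_in|[c0 [_ _ uniq_c]]] := circle_at_arrow pv.
  by have := all_in _ tc; rewrite pc.
by rewrite (uniq_c _ tc pc) (uniq_c _ tc' pc').
Qed.

Lemma compatible_covering : trimer_coverings (compatible p).
Proof.
split=> [u []//|v]; have [u comp mark] := compatible_marks_exists v.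
exists u; split; first by split=> //; exact: marks_covered mark.
move=> u' [comp' /covered_marks[|s mark']]; first by case: comp'.
have ps : p v = s by case: comp' => _; apply.
by apply: (compatible_marks_unique comp comp' mark); rewrite ps.
Qed.

Lemma arrow_pattern_compatible : arrow_pattern (compatible p) = p.
Proof.
apply: funext => v; apply/(arrow_pattern_marks compatible_covering).
exact: compatible_marks_exists.
Qed.

End Admissible.

(** * The two maps are mutually inverse *)

(** Both sides are coverings and [T] is contained in the other, which forces equality: at any vertex
    of a compatible trimer, the trimer of [T] there is also compatible, so the two coincide. *)
Lemma compatible_arrow_pattern T :
  trimer_coverings T -> compatible (arrow_pattern T) = T.
Proof.
move=> covT.
have sub : T `<=` compatible (arrow_pattern T).
  move=> u Tu; split; first by case: covT => + _; apply.
  by move=> v s mark; apply/arrow_pattern_marks => //; exists u.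
apply/seteqP; split=> // u comp.
have [v uv] := covered_nonempty (proj1 comp).
have := compatible_covering (arrow_pattern_arrow covT) (arrow_pattern_profile covT).
case=> _ /(_ v)[u0 [_ uniq_u]].
have [u' [[Tu' u'v] _]] := (proj2 covT) v.
by rewrite -(uniq_u u) // (uniq_u u') //; split=> //; exact: sub.
Qed.

Theorem mainTheorem1 :
  (forall T : set trimer, trimer_coverings T ->
     forall v : vertex, exists! s : symbol, receives T v s) /\
  set_bij trimer_coverings admissible_patterns arrow_pattern.
Proof.
split; first by move=> T covT v; exact: receives_exists_unique.
split.
- move=> T covT; split; first exact: arrow_pattern_arrow.
  by move=> t; apply/locally_admissibleP; exact: arrow_pattern_profile.
- move=> T T' /set_mem covT /set_mem covT' eqT.
  by rewrite -(compatible_arrow_pattern covT) eqT compatible_arrow_pattern.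
move=> p [arrow_p adm_p].
have profile_p t : in_out_profile p t by apply/locally_admissibleP; exact: adm_p.
exists (compatible p); first exact: compatible_covering.
exact: arrow_pattern_compatible.
Qed.
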